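(* Let $(G,\tau)$, $(K,\rho)$, $(H,\sigma)$ be topological groups, let $f_1:(G,\tau)\to(K,\rho)$ and $f_2:(K,\rho)\to(H,\sigma)$ be continuous surjective homomorphisms, and let $f=f_2\circ f_1$. (a) If $f$ is strongly A-open, then $f_1$ is strongly A-open. (b) If $f_1$ is open and $f$ is strongly A-open, then $f_2$ is strongly A-open.
   Context: Topological groups are not assumed Hausdorff. $\mathcal V_{(G,\tau)}(e_G)$ is the filter of all neighborhoods of $e_G$ in $(G,\tau)$. For a neighborhood $U$ of $e_G$, a subset $M\subseteq G$ is $U$-thin if $\bigcap\{x^{-1}Ux:x\in M\}$ is a neighborhood of $e_G$. Write $[x,y]=xyx^{-1}y^{-1}$ and, for $g\in G$ and $K\subseteq G$, $[g,K]=\{[g,k]:k\in K\}$. A homomorphism $f:(G,\tau)\to(H,\sigma)$ is strongly A-open if for every $U\in\mathcal V_{(G,\tau)}(e_G)$: (a) there exists $V\in\mathcal V_{(H,\sigma)}(e_H)$ such that $f^{-1}(V)$ is $U$-thin; (b) for every $g\in G$ there exists $V_g\in\mathcal V_{(H,\sigma)}(e_H)$ such that $[g,f^{-1}(V_g)]\subseteq U$. *)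

(* Defs.v *)
From HB Require Import structures.
From mathcomp Require Import all_boot.
From mathcomp Require Import boolp classical_sets functions topology.

Set Implicit Arguments.
Unset Strict Implicit.
Unset Printing Implicit Defensive.

Local Open Scope classical_set_scope.
Local Open Scope group_scope.

HB.structure Definition PreTopologicalGroup :=
  {G of Topological G & Group G}.

HB.mixin Record PreTopologicalGroup_isTopologicalGroup G
    & PreTopologicalGroup G := {
  mulg_continuous : continuous (fun x : G * G => x.1 * x.2) ;
  invg_continuous : continuous (fun x : G => x^-1) ;
}.

(* As everywhere in the library, no separation axiom is part of the topology. *)
#[short(type="topologicalGroupType")]
HB.structure Definition TopologicalGroup :=
  {G of PreTopologicalGroup G & PreTopologicalGroup_isTopologicalGroup G}.

Definition thin (G : topologicalGroupType) (U M : set G) : Prop :=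
  nbhs (1 : G) (\bigcap_(x in M) [set x^-1 * u * x | u in U]).

(* The library's [~ x, y] is x^-1 * y^-1 * x * y, a different convention. *)
Definition commutator (G : groupType) (x y : G) : G := x * y * x^-1 * y^-1.

Definition strongly_A_open (G H : topologicalGroupType)
    (f : {multiplicative G -> H}) : Prop :=
  forall U : set G, nbhs (1 : G) U ->
    (exists2 V : set H, nbhs (1 : H) V & thin U (f @^-1` V)) /\
    (forall g : G, exists2 V : set H, nbhs (1 : H) V &
       [set commutator g k | k in f @^-1` V] `<=` U).

Definition open_map (X Y : topologicalType) (f : X -> Y) : Prop :=
  forall A : set X, open A -> open (f @` A).

(* Main.v *)
Require Import Defs.
From mathcomp Require Import all_boot.
From mathcomp Require Import boolp classical_sets functions topology.

(** Both halves transport witnesses along one of the two factors.  For the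
first, f^-1(V) = f1^-1(f2^-1(V)), so pulling a witness V for f back along f2
gives one for f1; continuity of f2 keeps it a neighborhood of the identity.
For the second, given U in K, a witness V for f and the neighborhood f1^-1(U)
is already a witness for f2 and U: by surjectivity of f1 the set f2^-1(V) is
the f1-image of f^-1(V), a homomorphism sends commutators to commutators, and
an open homomorphism sends f1^-1(U)-thin sets to U-thin sets
([thin_image]). *)

Local Open Scope classical_set_scope.
Local Open Scope group_scope.

(** A map of type [{multiplicative G -> H}] is only asked to preserve products;
between groups, cancelling in f(1) f(x) = f(x) shows that it preserves the
identity, hence inverses. *)
Lemma multiplicative_one (G H : groupType) (f : {multiplicative G -> H}) :
  f 1 = 1.
Proof. by apply: (@mulgI _ (f 1)); rewrite -gmulfM !mulg1. Qed.

Lemma multiplicative_inv (G H : groupType) (f : {multiplicative G -> H}) :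
  {morph f : x / x^-1}.
Proof.
by move=> x; apply: (@mulgI _ (f x)); rewrite -gmulfM !mulgV multiplicative_one.
Qed.

Lemma nbhs1_preimage (G H : topologicalGroupType) (f : {multiplicative G -> H})
  (U : set H) : continuous f -> nbhs (1 : H) U -> nbhs (1 : G) (f @^-1` U).
Proof. by move=> cf nU; apply: cf; rewrite multiplicative_one. Qed.

Lemma nbhs1_image (G H : topologicalGroupType) (f : {multiplicative G -> H})
  (U : set G) : open_map f -> nbhs (1 : G) U -> nbhs (1 : H) (f @` U).
Proof.
move=> of_; rewrite !nbhsE => -[A [oA A1] AU].
exists (f @` A); last exact: image_subset.
by split; [exact: of_ | exists 1; rewrite ?multiplicative_one].
Qed.

Lemma commutator_morph (G H : groupType) (f : {multiplicative G -> H})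
  (x y : G) : f (commutator x y) = commutator (f x) (f y).
Proof. by rewrite /commutator !gmulfM !multiplicative_inv. Qed.

(** The image of the intersection of the x^-1 f^-1(U) x over x in M lies in
every (f x)^-1 U (f x), and it is a neighborhood of the identity because f is
open. *)
Lemma thin_image (G H : topologicalGroupType) (f : {multiplicative G -> H})
  (U : set H) (M : set G) :
  open_map f -> thin (f @^-1` U) M -> thin U (f @` M).
Proof.
move=> of_ /(nbhs1_image _ _ _ _ of_); apply: filterS.
move=> _ [w wM <-] _ [x Mx <-].
have [u Uu <-] := wM x Mx.
by exists (f u) => //; rewrite !gmulfM multiplicative_inv.
Qed.

Lemma preimage_comp_surj (X Y Z : Type) (f : X -> Y) (g : Y -> Z) (V : set Z) :
  set_surj setT setT f -> g @^-1` V = f @` ((g \o f) @^-1` V).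
Proof.
move=> sf; apply/seteqP; split=> [y Vy | _ [x Vx <-] //].
by have [x _ xy] := sf y I; exists x; rewrite //= xy.
Qed.

Theorem proposition6p10 (G K H : topologicalGroupType)
  (f1 : {multiplicative G -> K}) (f2 : {multiplicative K -> H})
  (f1_cont : continuous f1) (f1_surj : set_surj [set: G] [set: K] f1)
  (f2_cont : continuous f2) (f2_surj : set_surj [set: K] [set: H] f2) :
  (strongly_A_open (f2 \o f1) -> strongly_A_open f1) /\
  (open_map f1 -> strongly_A_open (f2 \o f1) -> strongly_A_open f2).
Proof.
split=> [fA U nU | f1_open fA U nU].
- have [[V nV thV] fC] := fA U nU.
  split=> [|g]; first by exists (f2 @^-1` V) => //; exact: nbhs1_preimage.
  have [W nW gW] := fC g.
  by exists (f2 @^-1` W) => //; exact: nbhs1_preimage.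
- have [[V nV thV] fC] := fA _ (nbhs1_preimage _ _ _ _ f1_cont nU).
  split=> [|g].
    by exists V => //; rewrite (preimage_comp_surj _ _ _ f1)//; exact: thin_image.
  have [g' _ <-] := f1_surj g I.
  have [W nW gW] := fC g'.
  exists W => //; rewrite (preimage_comp_surj _ _ _ f1)//.
  move=> _ [_ [k Wk <-] <-]; rewrite -commutator_morph.
  by apply: gW; exists k.
Qed.
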